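(* Let $s,t,k,r$ be such that $t\ge 2$, and let $\mathcal{A}$ be a $k$-uniform $(r,t)$-spread family. Assume that $r\ge 2^{18}s(t+1)\log_2 r$ and $r\ge 2^{15}s\log_2 k$. Suppose that $\mathcal{F}\subset\mathcal{A}$ contains no sunflower with $s$ petals whose core has size at most $t-1$. Then there exists a family $\mathcal{T}\subset\partial_t\mathcal{A}$ containing no sunflower with $s$ petals such that $$|\mathcal{F}\setminus\mathcal{F}[\mathcal{T}]|\le(2^{14}s\log_2 t)^t\cdot\frac{2^{19}s(t+1)\log_2 r}{r}\cdot A_t.$$
   Context: A sunflower with $s$ petals is a family of $s$ distinct sets $F_1,\dots,F_s$ with $F_i\cap F_j=\bigcap_uF_u$ for all distinct $i,j$; $\bigcap_uF_u$ is its core. For a family $\mathcal{G}$ and a set $X$, $\mathcal{G}(X)=\{G\setminus X: G\in\mathcal{G},X\subset G\}$. A family $\mathcal{G}$ is $R$-spread if $|\mathcal{G}(X)|\le R^{-|X|}|\mathcal{G}|$ for every set $X$. The shadow is $\partial_h\mathcal{A}=\bigcup_{A\in\mathcal{A}}\binom{A}{h}$ and $\partial_{\le h}\mathcal{A}=\bigcup_{h'\le h}\partial_{h'}\mathcal{A}$. A $k$-uniform family $\mathcal{A}$ is $(r,t)$-spread if $\mathcal{A}(T)$ is $r$-spread for every $T\in\partial_{\le t}\mathcal{A}$. $A_t=\max_{T\in\partial_t\mathcal{A}}|\mathcal{A}(T)|$. For a family $\mathcal{T}$, $\mathcal{F}[\mathcal{T}]=\{F\in\mathcal{F}:\exists T\in\mathcal{T},\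 T\subset F\}$.
   Formalization: The formal statement adds s ≥ 2 (for s = 1 every single set is a sunflower, so T must be empty and the bound fails for F = A) and t ≤ k (otherwise the t-shadow of A is empty and A_t is undefined). *)

(* Defs.v *)
From mathcomp Require Import all_boot all_order all_algebra.
From mathcomp Require Import reals exp.

Set Implicit Arguments.
Unset Strict Implicit.
Unset Printing Implicit Defensive.

Import Order.TTheory GRing.Theory Num.Theory.
Local Open Scope ring_scope.

Definition log2 (R : realType) (x : R) : R := ln x / ln 2.

Section Families.
Variable V : finType.
Implicit Types (A F G S T : {set {set V}}) (X : {set V}).

Definition core S : {set V} := \bigcap_(P in S) P.

Definition sunflower (s : nat) S : Prop :=
  #|S| = s /\
  forall P Q, P \in S -> Q \in S -> P != Q -> P :&: Q = core S.

Definition link G X : {set {set V}} :=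
  [set P :\: X | P in G & X \subset P].

Definition spread (R : realType) (r : R) G : Prop :=
  forall X, #|link G X|%:R <= r ^- #|X| * #|G|%:R.

Definition uniform (k : nat) A : Prop := forall P, P \in A -> #|P| = k.

Definition shadow (h : nat) A : {set {set V}} :=
  \bigcup_(P in A) [set X : {set V} | X \subset P & #|X| == h].

Definition shadow_le (h : nat) A : {set {set V}} :=
  \bigcup_(h' < h.+1) shadow h' A.

Definition rt_spread (R : realType) (r : R) (t : nat) A : Prop :=
  forall X, X \in shadow_le t A -> spread r (link A X).

(* The maximum is 0 when the t-shadow of A is empty. *)
Definition max_degree (t : nat) A : nat :=
  (\max_(X in shadow t A) #|link A X|)%N.

(* F[T] *)
Definition containing F T : {set {set V}} :=
  [set P in F | [exists X in T, X \subset P]].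

End Families.

(* Main.v *)
(* Put R = r / 2 and q = floor ((t + 1) log2 r), and let S be the family of all sets
   B of size at most q such that some G(B) with G a subfamily of F is nonempty and
   R-spread. A subfamily of F avoiding S has a maximal B with |F(B)| >= R^-|B| |F|,
   of size greater than q, so it is tiny. The spread lemma turns a sunflower with
   small core in S into one in F, so S has none, and its members have size at least t.
   Next choose, among the families T of sets of size between t and q that contain a
   subset of each member of S and no sunflower with a small core, one minimising the
   sum of the sizes. By minimality no link T_i(X), t <= |X| < i, of the i-sets T_i of
   T is spread, whence |T_i(X)| <= b^(i - t) for |X| = t, and a second use of the
   spread lemma gives |T_i| <= (C s log2 i)^t b^(i - t). The members of F containing
   a set of T_i for some i > t are thus few, and the t-sets of T are the answer.

   The spread lemma is proved by the minimum-fragment argument of Park and Pham: in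
   a rho-spread family, adding an independent d-random set with rho d >= 128 halves
   the expected average size of what remains to be covered. *)
Require Import Defs.
From mathcomp Require Import all_boot all_order all_algebra.
From mathcomp Require Import reals exp.
From mathcomp Require Import boolp sequences ring lra zify.
Import Order.TTheory GRing.Theory Num.Theory.
Local Open Scope ring_scope.

Set Implicit Arguments.
Unset Strict Implicit.
Unset Printing Implicit Defensive.

(** * Random subsets with independent points, and random colourings *)

Section BiasedSubsets.
Variables (R : realType) (V : finType).
Implicit Types (p a b d : R) (W U Z D : {set V}).

(** The probability that a random subset of [V], containing each point independently with
    probability [p], equals [W]. Expectations are written as sums against this weight. *)
Definition biased p W : R := \prod_v (if v \in W then p else 1 - p).

Lemma prod_addr_sets (f g : V -> R) :
  \prod_v (f v + g v) = \sum_(W : {set V}) \prod_v (if v \in W then f v else g v).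
Proof. exact: bigA_distr. Qed.

Lemma biased_ge0 p W : 0 <= p <= 1 -> 0 <= biased p W.
Proof.
by move=> /andP[p0 p1]; apply: prodr_ge0 => v _; case: ifP; rewrite ?subr_ge0.
Qed.

Lemma sum_biased p : \sum_W biased p W = 1.
Proof.
rewrite /biased -(prod_addr_sets (fun=> p) (fun=> 1 - p)) big1 // => v _; ring.
Qed.

(** A point avoids two independent sets with probability [(1 - a) * (1 - b)], so their union is
    again a biased random set. The indicator of [W :|: U == Z] factors over the points, which lets
    both sums be evaluated pointwise. *)
Lemma biased_setU a b (phi : {set V} -> R) :
  \sum_W biased a W * (\sum_U biased b U * phi (W :|: U)) =
  \sum_Z biased (a + b - a * b) Z * phi Z.
Proof.
transitivity (\sum_W \sum_U \sum_Z
    biased a W * biased b U * (W :|: U == Z)%:R * phi Z).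
  apply: eq_bigr => W _; rewrite mulr_sumr; apply: eq_bigr => U _.
  rewrite (bigD1 (W :|: U)) //= eqxx mulr1 big1 ?addr0 ?mulrA // => Z.
  by rewrite eq_sym => /negPf ->; rewrite mulr0 mul0r.
under eq_bigr do rewrite exchange_big /=.
rewrite exchange_big /=; apply: eq_bigr => Z _.
under eq_bigr do rewrite -mulr_suml.
rewrite -mulr_suml; congr (_ * _).
have indE W U : (W :|: U == Z)%:R =
    \prod_v (((v \in W) || (v \in U)) == (v \in Z))%:R :> R.
  have [<-|/eqP neq] := eqVneq.
    by rewrite big1 // => v _; rewrite in_setU eqxx.
  have [v Hv] : exists v, ((v \in W) || (v \in U)) != (v \in Z).
    apply/existsP; apply: contraT => /existsPn H; case: neq.
    by apply/setP => v; rewrite in_setU; apply/eqP; move: (H v); rewrite negbK.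
  by rewrite (bigD1 v) //= (negPf Hv) mul0r.
transitivity (\sum_(W : {set V}) \prod_v ((if v \in W then a else 1 - a) *
   (b * ((v \in W) || true == (v \in Z))%:R
    + (1 - b) * ((v \in W) == (v \in Z))%:R))).
  apply: eq_bigr => W _; rewrite big_split /= prod_addr_sets mulr_sumr.
  apply: eq_bigr => U _; rewrite indE -mulrA -big_split /=; congr (_ * _).
  by apply: eq_bigr => v _; case: (v \in U); rewrite ?orbT ?orbF.
rewrite /biased.
transitivity (\prod_v (a * (b * (true == (v \in Z))%:R + (1 - b) * (true == (v \in Z))%:R)
   + (1 - a) * (b * (true == (v \in Z))%:R + (1 - b) * (false == (v \in Z))%:R))).
  rewrite prod_addr_sets; apply: eq_bigr => W _; apply: eq_bigr => v _.
  by case: (v \in W).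
by apply: eq_bigr => v _; case: (v \in Z) => /=; ring.
Qed.

(** Deleting [D] turns each of its factors [d] into [1 - d], which is at most 1, so each point of
    [D] costs at most [d^-1]. *)
Lemma biased_setD d Z D : 0 < d < 1 -> D \subset Z ->
  biased d (Z :\: D) <= biased d Z * d ^- #|D|.
Proof.
move=> /andP[d0 d1] DZ.
have -> : d ^- #|D| = \prod_v (if v \in D then d^-1 else 1).
  by rewrite -big_mkcond /= prodr_const exprVn.
rewrite /biased -big_split /=; apply: ler_prod => v _; rewrite in_setD.
have := subsetP DZ v; case: (v \in D) => /=.
  move=> /(_ isT) ->; rewrite mulfV ?gt_eqF //; lra.
by move=> _; case: ifP => _; lra.
Qed.

(** In a uniform random colouring each colour class is an [m^-1]-random set; the factor
    [m%:R ^+ #|V|] counts the colourings. *)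
Lemma sum_colour_class (m : nat) (j : 'I_m) (phi : {set V} -> R) :
  \sum_(c : {ffun V -> 'I_m}) phi [set v | c v == j] =
  m%:R ^+ #|V| * \sum_W biased m%:R^-1 W * phi W.
Proof.
have m0 : m%:R != 0 :> R by rewrite pnatr_eq0 -lt0n; case: m j => // -[].
rewrite (partition_big (fun c : {ffun V -> 'I_m} => [set v | c v == j]) xpredT) //=.
rewrite mulr_sumr; apply: eq_bigr => W _.
transitivity (\sum_(c : {ffun V -> 'I_m})
    (\prod_v (((c v) == j) == (v \in W))%:R) * phi W).
  rewrite big_mkcond; apply: eq_bigr => c _; case: eqP => [<-|neq].
    by rewrite big1 ?mul1r // => v _; rewrite inE eqxx.
  have [v Hv] : exists v, (c v == j) != (v \in W).
    apply/existsP; apply: contraT => /existsPn H; case: neq.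
    by apply/setP => v; rewrite inE; have := H v; rewrite negbK => /eqP.
  by rewrite (bigD1 v) //= (negPf Hv) !mul0r.
rewrite -mulr_suml mulrA; congr (_ * _).
have -> : \sum_(c : {ffun V -> 'I_m}) \prod_v ((c v == j) == (v \in W))%:R =
    \prod_v \sum_(a < m) ((a == j) == (v \in W))%:R :> R.
  by rewrite bigA_distr_bigA.
have -> : m%:R ^+ #|V| = \prod_(v : V) m%:R :> R by rewrite prodr_const.
rewrite /biased -big_split /=.
have cardP (P : pred 'I_m) : \sum_(a < m) (P a)%:R = #|P|%:R :> R.
  by rewrite -sum1_card natr_sum [in RHS]big_mkcond; apply: eq_bigr => a _; rewrite unfold_in; case: (P a).
apply: eq_bigr => v _; case: (v \in W).
  rewrite mulfV //; under eq_bigr do rewrite eqb_id.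
  by rewrite cardP card1.
under eq_bigr do rewrite eqbF_neg.
rewrite (cardP (predC1 j)) mulrBr mulr1 mulfV //.
have := cardC1 j; rewrite card_ord => ->.
by case: m j {m0 cardP} => [[]//|m] _; rewrite /= mulrS; ring.
Qed.

End BiasedSubsets.

(** * Minimum fragments and the spread lemma *)

Section Fragments.
Variables (R : realType) (V I : finType) (G : {set I}).
Implicit Types (f : I -> {set V}) (W U Z D X : {set V}) (i j : I).

(** The size condition ensures that a smallest member inside the union of [W] and the fragment of
    [i] is no larger than [f i]. *)
Definition fragment_cand f W i : pred I :=
  fun j => [&& j \in G, f j \subset f i :|: W & (#|f j| <= #|f i|)%N].

(** The Park-Pham minimum fragment: the least part left uncovered by [W] among the candidates. The
    default [i] is a candidate whenever it lies in [G]. *)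
Definition fragment f W i : {set V} :=
  f [arg min_(j < i | fragment_cand f W i j) #|f j :\: W|] :\: W.

Lemma fragmentP f W i : i \in G ->
  exists j, [/\ fragment_cand f W i j, fragment f W i = f j :\: W &
    forall j', fragment_cand f W i j' -> (#|f j :\: W| <= #|f j' :\: W|)%N].
Proof.
move=> iG; rewrite /fragment; case: arg_minnP => [|j cj minj].
  by rewrite /fragment_cand iG subsetUl /=.
by exists j.
Qed.

Lemma fragment_sub f W i : i \in G -> fragment f W i \subset f i.
Proof.
move=> /(fragmentP f W)[j [/and3P[_ sub _] -> _]].
by rewrite subDset setUC.
Qed.

Definition misses f W : bool := ~~ [exists i in G, f i \subset W].

(** If [U] contains the fragment [f j :\: W], then [W :|: U] contains [f j]; once [W] is revealed,
    only fragments remain to be covered. *)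
Lemma misses_fragment f W U : misses f (W :|: U) -> misses (fragment f W) U.
Proof.
apply: contra => /existsP[i /andP[iG sub]].
have [j [/and3P[jG _ _] E _]] := fragmentP f W iG.
by apply/existsP; exists j; rewrite jG /= -subDset -E.
Qed.

(** Indices are counted rather than sets, because different members may have equal fragments. With
    multiplicity, spreadness survives replacing each [f i] by a subset. *)
Definition index_spread (rho : R) f : Prop :=
  forall X, #|[set i in G | X \subset f i]|%:R <= rho ^- #|X| * #|G|%:R.

Lemma index_spread_sub (rho : R) (f g : I -> {set V}) :
  {in G, forall i, g i \subset f i} -> index_spread rho f -> index_spread rho g.
Proof.
move=> gf spf X; apply: le_trans (spf X); rewrite ler_nat subset_leq_card //.
apply/subsetP => i; rewrite !inE => /andP[iG Xg]; rewrite iG /=.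
exact: subset_trans (gf i iG).
Qed.

(* A long fragment D of i with respect to W is a subset of the smallest f j
   inside Z = W :|: D, so Z leaves at most 2 ^ #|f j| < 16 ^ #|D| choices
   of D. *)
Lemma long_fragments_at f (rho d : R) Z : 0 < d -> 0 < rho -> 128 <= rho * d ->
  index_spread rho f ->
  \sum_(D : {set V} | D \subset Z)
     \sum_(i in G | (fragment f (Z :\: D) i == D) && (#|f i| < 4 * #|D|)%N)
        #|D|%:R * d ^- #|D| <= #|G|%:R / 4.
Proof.
move=> d0 rho0 rd spf.
(* If no member lies in [Z] the sum is empty: a fragment [D] of the form [f j :\: (Z :\: D)] inside
   [Z] would put [f j] inside [Z]. *)
have [/existsP[j0 j0P]|/existsPn noj] := boolP [exists j, (j \in G) && (f j \subset Z)]; last first.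
  rewrite big1 ?divr_ge0 // => D DZ; rewrite big1 // => i /andP[iG /andP[/eqP E _]].
  have [j [/and3P[jG _ _] E' _]] := fragmentP f (Z :\: D) iG.
  have := noj j; rewrite jG /= => /negP[]; apply/subsetP => v vj.
  have [vZ|vZ] := boolP (v \in Z :\: D); first by move: vZ; rewrite inE => /andP[].
  by apply: (subsetP DZ); rewrite -E E' inE vZ vj.
pose P j := (j \in G) && (f j \subset Z).
case: (@arg_minnP _ j0 P (fun j => #|f j|) j0P) => js /andP[jsG jsZ] jsmin.
(* The smallest member [f js] inside [Z] is a candidate for [i]. Minimality of the fragment forces
   [f js :\: (Z :\: D)], a subset of [D], to have at least [#|D|] elements, hence to equal [D]. *)
have key D i : D \subset Z -> i \in G -> fragment f (Z :\: D) i = D ->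
    (#|f i| < 4 * #|D|)%N ->
    [/\ D \subset f js, D \subset f i & (#|f js| < 4 * #|D|)%N].
  move=> DZ iG E lt.
  have Di : D \subset f i by rewrite -{1}E fragment_sub.
  have [j [/and3P[jG jsub jle] E' minj]] := fragmentP f (Z :\: D) iG.
  have jZ : f j \subset Z.
    apply/subsetP => v vj.
    have [vZ|vZ] := boolP (v \in Z :\: D); first by move: vZ; rewrite inE => /andP[].
    by apply: (subsetP DZ); rewrite -E E' inE vZ vj.
  have le_js : (#|f js| <= #|f i|)%N.
    by apply: leq_trans jle; apply: jsmin; rewrite /P jG.
  have cand : fragment_cand f (Z :\: D) i js.
    rewrite /fragment_cand jsG le_js andbT /=; apply: subset_trans jsZ _.
    apply/subsetP => v vZ; rewrite !inE vZ andbT.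
    by case vD: (v \in D); rewrite ?orbT // (subsetP Di).
  have := minj _ cand; rewrite -E' E => leD.
  have subD : f js :\: (Z :\: D) \subset D.
    apply/subsetP => v; rewrite !inE negb_and negbK => /andP[/orP[//|nZ] vjs].
    by rewrite (subsetP jsZ) in nZ.
  have /eqP eqD : f js :\: (Z :\: D) == D by rewrite eqEcard subD.
  split=> //; last exact: leq_ltn_trans lt.
  by rewrite -eqD subsetDl.
set l := #|f js| in key *.
pose x : R := (rho * d)^-1.
have x0 : 0 <= x by rewrite invr_ge0 mulr_ge0 ?ltW.
have x128 : x <= 128^-1 by rewrite lef_pV2 ?posrE ?mulr_gt0.
have bound D : D \subset f js -> (l < 4 * #|D|)%N ->
    #|D|%:R * x ^+ #|D| <= 2 ^- l / 4.
  move=> _ lt.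
  have Dpos : (0 < #|D|)%N by lia.
  have h1 : #|D|%:R <= 2 ^+ #|D| :> R.
    by rewrite -natrX ler_nat ltnW // ltn_expl.
  have h2 : x ^+ #|D| <= (128^-1) ^+ #|D| by apply: lerXn2r; rewrite ?nnegrE // invr_ge0.
  apply: le_trans (ler_pM _ _ h1 h2) _; rewrite ?ler0n ?exprn_ge0 //.
  rewrite -exprMn.
  (* The power of 1/16 pays for the [2 ^ l] subsets of [f js], as [l < 4 * #|D|]; the power of 1/4
     leaves the final factor 1/4. *)
  have -> : 2 * 128^-1 = (2 ^+ 4)^-1 * 4^-1 :> R by field.
  rewrite exprMn; apply: ler_pM; rewrite ?exprn_ge0 ?invr_ge0 ?exprn_ge0 //.
    rewrite -exprVn -exprM -exprVn; apply: ler_wiXn2l; rewrite ?invr_ge0 ?invf_le1 //; first by lra.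
    by rewrite ltnW.
  rewrite -[leRHS]expr1; apply: ler_wiXn2l => //; rewrite ?invr_ge0 ?invf_le1 //; lra.
apply: (@le_trans _ _ (\sum_(D : {set V} | D \subset f js) 2 ^- l / 4 * #|G|%:R)); last first.
  rewrite sumr_const.
  have -> : #|[pred D : {set V} | D \subset f js]| = (2 ^ l)%N.
    by rewrite -card_powerset; apply: eq_card => D; rewrite !inE.
  rewrite -[_ *+ (2 ^ l)]mulr_natr natrX.
  have : (2 ^+ l : R) != 0 by rewrite expf_neq0 // pnatr_eq0.
  by move: (2 ^+ l) => y y0; rewrite le_eqVlt; apply/orP; left; apply/eqP; field.
rewrite [leRHS]big_mkcond [leLHS]big_mkcond /=; apply: ler_sum => D _.
case: ifP => DZ; last by case: ifP => _ //; rewrite !mulr_ge0 ?invr_ge0 ?exprn_ge0.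
rewrite sumr_const -[_ *+ #|_|]mulr_natr.
have [/andP[Djs lt]|nD] := boolP ((D \subset f js) && (l < 4 * #|D|)%N); last first.
  rewrite [X in _ * X%:R](_ : _ = 0%N) ?mulr0.
    by case: ifP => _ //; rewrite !mulr_ge0 ?invr_ge0 ?exprn_ge0.
  apply: eq_card0 => i; rewrite inE; apply/negP => /andP[iG /andP[/eqP E li]].
  by have [h1 h2 h3] := key D i DZ iG E li; rewrite h1 h3 in nD.
rewrite Djs.
apply: (@le_trans _ _ (#|D|%:R * d ^- #|D| * (rho ^- #|D| * #|G|%:R))).
  apply: ler_wpM2l; first by rewrite mulr_ge0 ?invr_ge0 ?exprn_ge0 ?(ltW d0).
  apply: le_trans (spf D); rewrite ler_nat subset_leq_card //.
  apply/subsetP => i; rewrite !inE => /andP[iG /andP[/eqP E li]].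
  by have [h1 h2 h3] := key D i DZ iG E li; rewrite iG.
have -> : #|D|%:R * d ^- #|D| * (rho ^- #|D| * #|G|%:R) =
    #|D|%:R * x ^+ #|D| * #|G|%:R.
  by rewrite /x invfM exprMn !exprVn; ring.
by apply: ler_wpM2r => //; apply: bound.
Qed.

(** Fragments of at most a quarter of [#|f i|] add up to at most a quarter of the total size. The
    longer ones contribute at most [#|G| / 4] on average, again at most a quarter of the total
    because no [f i] is empty. *)
Lemma fragment_shrink f (rho d : R) : 0 < d < 1 -> 0 < rho -> 128 <= rho * d ->
  index_spread rho f -> {in G, forall i, f i != set0} ->
  \sum_W biased d W * (\sum_(i in G) #|fragment f W i|%:R) <=
    2^-1 * \sum_(i in G) #|f i|%:R.
Proof.
move=> /andP[d0 d1] rho0 rd spf fn0.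
have bpos W : 0 <= biased d W by rewrite biased_ge0 ?ltW.
pose long W i := (#|f i| < 4 * #|fragment f W i|)%N.
have split_le W : \sum_(i in G) #|fragment f W i|%:R <=
   4^-1 * \sum_(i in G) #|f i|%:R + \sum_(i in G | long W i) #|fragment f W i|%:R :> R.
  rewrite mulr_sumr [X in _ + X]big_mkcondr -big_split /=; apply: ler_sum => i _.
  rewrite /long; case: ltnP => [_|]; first by rewrite lerDr mulr_ge0 ?invr_ge0.
  by rewrite -(ler_nat R) natrM addr0; lra.
apply: (@le_trans _ _ (4^-1 * (\sum_(i in G) #|f i|%:R) + #|G|%:R / 4)); last first.
  have : #|G|%:R <= \sum_(i in G) #|f i|%:R :> R.
    rewrite -natr_sum ler_nat -sum1_card; apply: leq_sum => i iG.
    by rewrite card_gt0 fn0.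
  lra.
apply: (@le_trans _ _ (\sum_W (biased d W * (4^-1 * \sum_(i in G) #|f i|%:R) +
     biased d W * \sum_(i in G | long W i) #|fragment f W i|%:R))).
  by apply: ler_sum => W _; rewrite -mulrDr ler_wpM2l.
rewrite big_split /= -mulr_suml sum_biased mul1r lerD2l.
have -> : \sum_W biased d W * (\sum_(i in G | long W i) #|fragment f W i|%:R) =
  \sum_(D : {set V}) \sum_(W : {set V} | [disjoint W & D]) biased d W *
    \sum_(i in G | (fragment f W i == D) && (#|f i| < 4 * #|D|)%N) #|D|%:R.
  transitivity (\sum_W \sum_(D : {set V}) biased d W *
    \sum_(i in G | (fragment f W i == D) && (#|f i| < 4 * #|D|)%N) #|D|%:R).
    apply: eq_bigr => W _; rewrite -mulr_sumr; congr (_ * _).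
    rewrite (partition_big (fragment f W) xpredT) //=; apply: eq_bigr => D _.
    apply: congr_big => // [i|i /andP[_ /eqP -> //]].
    by rewrite /long -andbA; case: eqP => [->|]; rewrite ?andbT ?andbF.
  rewrite exchange_big /=; apply: eq_bigr => D _.
  rewrite [RHS]big_mkcond; apply: eq_bigr => W _; case: ifPn => // nd.
  rewrite big_pred0 ?mulr0 // => i; apply/negP => /andP[iG /andP[/eqP E _]].
  case/negP: nd; rewrite -E; have [j [_ -> _]] := fragmentP f W iG.
  by rewrite -setI_eq0; apply/eqP/setP => v; rewrite !inE; case: (v \in W).
(* A fragment [D] is disjoint from [W], so the pair is recovered from [D] and [Z = W :|: D]. This
   permits the bound at fixed [Z], and [biased_setD] accounts for the change of weight. *)
have -> : \sum_(D : {set V}) \sum_(W : {set V} | [disjoint W & D]) biased d W *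
    \sum_(i in G | (fragment f W i == D) && (#|f i| < 4 * #|D|)%N) #|D|%:R =
  \sum_(D : {set V}) \sum_(Z : {set V} | D \subset Z) biased d (Z :\: D) *
    \sum_(i in G | (fragment f (Z :\: D) i == D) && (#|f i| < 4 * #|D|)%N) #|D|%:R :> R.
  apply: eq_bigr => D _.
  rewrite (reindex_onto (fun Z => Z :\: D) (fun W => W :|: D)) /=; last first.
    move=> W /setDidPl WD; rewrite setDUl setDv setU0 //.
  apply: eq_bigl => Z; rewrite (_ : [disjoint _ & _]) /=; last first.
    by rewrite -setI_eq0; apply/eqP/setP => v; rewrite !inE; case: (v \in D); rewrite ?andbF.
  apply/eqP/idP => [<-|DZ]; first exact: subsetUr.
  apply/setP => v; rewrite !inE; have := subsetP DZ v.
  by case: (v \in D) => [/(_ isT) ->|_]; rewrite ?orbT ?orbF.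
rewrite (exchange_big_dep xpredT) //=.
have -> : #|G|%:R / 4 = \sum_(Z : {set V}) biased d Z * (#|G|%:R / 4).
  by rewrite -mulr_suml sum_biased mul1r.
apply: ler_sum => Z _.
apply: le_trans (ler_wpM2l (bpos Z) (long_fragments_at Z d0 rho0 rd spf)).
rewrite mulr_sumr; apply: ler_sum => D DZ.
rewrite -mulr_suml [leRHS]mulrA [leRHS]mulrAC; apply: ler_wpM2r; first exact: sumr_ge0.
by rewrite biased_setD ?d0.
Qed.

(** The random set is revealed in [n] rounds of density [d], each halving the expected total size of
    the fragments. At the end a missed family has only nonempty sets, so its cardinality is at most
    that total. *)
Lemma misses_bound n f (rho d p : R) : 0 < d < 1 -> 0 < rho -> 128 <= rho * d ->
  n%:R * d <= p -> 0 <= p <= 1 -> index_spread rho f ->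
  (\sum_W biased p W * (misses f W)%:R) * #|G|%:R <=
    2 ^- n * \sum_(i in G) #|f i|%:R.
Proof.
move=> d01 rho0 rd; have /andP[d0 d1] := d01.
(* When some [f i] is empty nothing is missed; the [try] block settles this case both for [n = 0]
   and in the induction step. *)
elim: n f p => [|n IH] f p np p01 spf;
  have [/forallP fn0|/forallPn[i]] := boolP [forall i, (i \in G) ==> (f i != set0)];
  try (rewrite negb_imply negbK => /andP[iG /eqP fi0];
    rewrite big1 ?mul0r ?mulr_ge0 ?invr_ge0 ?exprn_ge0 ?sumr_ge0 // => W _;
    rewrite /misses (_ : [exists _ in _, _]) ?mulr0 //;
    by apply/existsP; exists i; rewrite iG fi0 sub0set).
- rewrite expr0 invr1 mul1r.
  apply: (@le_trans _ _ #|G|%:R).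
    rewrite -[leRHS]mul1r ler_wpM2r // -[leRHS](sum_biased V p) ler_sum // => W _.
    by case: misses; rewrite ?mulr1 ?mulr0; [|exact: biased_ge0].
  rewrite -natr_sum ler_nat -sum1_card; apply: leq_sum => i iG.
  by rewrite card_gt0; have := fn0 i; rewrite iG.
have fn0' : {in G, forall i, f i != set0}.
  by move=> i iG; have := fn0 i; rewrite iG.
(* The density left for the remaining rounds, obtained by solving [p = d + b - d * b]. *)
pose b := (p - d) / (1 - d).
have d1' : 0 < 1 - d by lra.
have pE : p = d + b - d * b by rewrite /b; field; rewrite gt_eqF.
have /andP[p0 p1] := p01.
rewrite -natr1 in np.
have dn0 : 0 <= n%:R * d by rewrite mulr_ge0 ?(ltW d0).
have nb : n%:R * d <= b.
  rewrite /b ler_pdivlMr //.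
  have : n%:R * d * (1 - d) <= n%:R * d by rewrite ler_piMr //; lra.
  lra.
have b01 : 0 <= b <= 1.
  by rewrite (le_trans dn0 nb) /b ler_pdivrMr //; lra.
rewrite pE -biased_setU.
have shrink := fragment_shrink d01 rho0 rd spf fn0'.
apply: (@le_trans _ _ (\sum_W biased d W *
    (2 ^- n * \sum_(i in G) #|fragment f W i|%:R))).
  rewrite mulr_suml; apply: ler_sum => W _; rewrite -mulrA.
  apply: ler_wpM2l; first by rewrite biased_ge0 ?ltW.
  have spg : index_spread rho (fragment f W).
    by apply: index_spread_sub spf => i; exact: fragment_sub.
  apply: le_trans (IH _ _ nb b01 spg).
  apply: ler_wpM2r => //; apply: ler_sum => U _.
  apply: ler_wpM2l; first by rewrite biased_ge0.
  by rewrite ler_nat; case E: misses => //; rewrite (misses_fragment E).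
under eq_bigr do rewrite mulrCA.
rewrite -mulr_sumr exprS invfM [_ * 2 ^- n]mulrC -mulrA.
by apply: ler_wpM2l; rewrite ?invr_ge0 ?exprn_ge0.
Qed.

End Fragments.

(** * Links and cores of sunflowers *)

Section Links.
Variables (V : finType).
Implicit Types (G H S : {set {set V}}) (B C D P Q X : {set V}).

Lemma in_link G X Q : (Q \in link G X) = [disjoint Q & X] && (Q :|: X \in G).
Proof.
apply/imsetP/andP => [[P /setIdP[PG XP] ->]|[QX QXG]].
  split; first by rewrite -setI_eq0; apply/eqP/setP => v; rewrite !inE; case: (v \in X); rewrite ?andbF.
  suff -> : P :\: X :|: X = P by [].
  apply/setP => v; rewrite !inE; have := subsetP XP v.
  by case: (v \in X) => [/(_ isT) ->|_]; rewrite ?orbF.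
exists (Q :|: X); first by rewrite !inE QXG subsetUr.
by rewrite setDUl setDv setU0; apply/esym/setDidPl.
Qed.

Lemma card_link G X : #|link G X| = #|[set P in G | X \subset P]|.
Proof.
rewrite card_in_imset // => P Q; rewrite !inE => /andP[_ XP] /andP[_ XQ] E.
apply/setP => v; move/setP/(_ v): E; rewrite !inE.
by case vX: (v \in X) => //= _; rewrite (subsetP XP) // (subsetP XQ).
Qed.

Lemma link_link G B X : [disjoint X & B] -> link (link G B) X = link G (B :|: X).
Proof.
move=> XB; apply/setP => Q; rewrite !in_link andbA.
rewrite (setUC B) setUA; congr (_ && _).
by rewrite -!setI_eq0 setIUl setIUr !setU_eq0 (setI_eq0 X) XB andbT andbC.
Qed.

Lemma link_link0 G B X : ~~ [disjoint X & B] -> link (link G B) X = set0.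
Proof.
move=> XB; apply/setP => Q; rewrite !in_link inE.
rewrite -[[disjoint Q :|: X & B]]setI_eq0 setIUl setU_eq0 (setI_eq0 X) (negPf XB).
by rewrite !andbF.
Qed.

Lemma link0 G : link G set0 = G.
Proof. by apply/setP => Q; rewrite in_link setU0 -setI_eq0 setI0 eqxx. Qed.

Lemma linkS G H X : G \subset H -> link G X \subset link H X.
Proof.
by move=> /subsetP GH; apply/subsetP => Q; rewrite !in_link => /andP[-> /GH].
Qed.

Lemma card_bigcup_le (I U : finType) (A : pred I) (F : I -> {set U}) :
  (#|\bigcup_(i | A i) F i| <= \sum_(i | A i) #|F i|)%N.
Proof.
elim/big_rec2: _ => [|i m X _ IH]; first by rewrite cards0.
by rewrite cardsU (leq_trans (leq_subr _ _)) // leq_add2l.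
Qed.

(** Since there are at least two petals, each petal belongs to a pair meeting in [C], so the
    intersection of all petals is [C] too. *)
Lemma sunflower_core s S C : (2 <= s)%N -> #|S| = s ->
    (forall P Q, P \in S -> Q \in S -> P != Q -> P :&: Q = C) ->
  sunflower s S /\ core S = C.
Proof.
move=> s2 cS SC.
have other P : P \in S -> exists2 Q, Q \in S & P != Q.
  move=> PS; have : (0 < #|S :\ P|)%N by move: s2; rewrite -cS (cardsD1 P) PS.
  by rewrite card_gt0 => /set0Pn[Q /setD1P[QP QS]]; exists Q; rewrite 1?eq_sym.
suff E : core S = C by split=> //; split=> // P Q *; rewrite E; apply: SC.
apply/eqP; rewrite eqEsubset; apply/andP; split; last first.
  apply/bigcapsP => P PS; have [Q QS PQ] := other P PS.
  by rewrite -(SC P Q) // subsetIl.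
have [P PS] : exists P, P \in S by apply/set0Pn; rewrite -card_gt0 cS; lia.
have [Q QS PQ] := other P PS.
by rewrite -(SC P Q) // subsetI !bigcap_inf.
Qed.

Lemma sunflower_image s (P : 'I_s -> {set V}) C : (2 <= s)%N -> injective P ->
    (forall i j, i != j -> P i :&: P j = C) ->
  sunflower s [set P i | i in 'I_s] /\ core [set P i | i in 'I_s] = C.
Proof.
move=> s2 injP PC; apply: sunflower_core => //.
  by rewrite card_imset // card_ord.
move=> _ _ /imsetP[i _ ->] /imsetP[j _ ->] neq; apply: PC.
by apply: contraNneq neq => ->.
Qed.

End Links.

(** * Spread families and disjoint members found by colouring *)

Section Spread.
Variables (R : realType) (V : finType).
Implicit Types (r rho p : R) (G H : {set {set V}}) (B D X : {set V}).

(** Union bound over the points of [D]: each lies in at most a fraction [1 / r] of the members. *)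
Lemma spread_meet r G D : 0 < r -> spread r G ->
  r * #|[set Q in G | ~~ [disjoint Q & D]]|%:R <= #|D|%:R * #|G|%:R.
Proof.
move=> r0 spG.
apply: (@le_trans _ _ (r * \sum_(u in D) #|link G [set u]|%:R)).
  rewrite ler_pM2l // -natr_sum ler_nat.
  apply: (@leq_trans #|\bigcup_(u in D) [set Q in G | [set u] \subset Q]|).
    apply/subset_leq_card/subsetP => Q; rewrite inE => /andP[QG].
    rewrite -setI_eq0 => /set0Pn[u /setIP[uQ uD]]; apply/bigcupP; exists u => //.
    by rewrite inE QG sub1set.
  apply: leq_trans (card_bigcup_le _ _) _.
  by apply: leq_sum => u _; rewrite card_link.
rewrite mulr_sumr mulr_natl -sumr_const; apply: ler_sum => u _.
have := spG [set u]; rewrite cards1 expr1 => le.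
by rewrite -ler_pdivlMl.
Qed.

(** Take a largest [B] with [#|link G B|] at least [r ^- #|B| * #|G|]. A nonempty [X] violating
    spreadness of its link would make [B :|: X] a larger such set. *)
Lemma exists_spread_link r G : 0 < r -> G != set0 ->
  exists B, [/\ #|G|%:R <= r ^+ #|B| * #|link G B|%:R, link G B != set0 &
                spread r (link G B)].
Proof.
move=> r0 Gn0.
have G0 : 0 < #|G|%:R :> R by rewrite ltr0n card_gt0.
pose dense B := #|G|%:R <= r ^+ #|B| * #|link G B|%:R.
have d0 : dense set0 by rewrite /dense cards0 expr0 mul1r link0.
case: (@arg_maxnP _ set0 dense (fun B : {set V} => #|B|) d0) => B dB maxB.
exists B; split=> //.
  rewrite -card_gt0 -(ltr0n R); have := lt_le_trans G0 dB.
  by rewrite pmulr_rgt0 // exprn_gt0.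
move=> X; have [XB|XB] := boolP [disjoint X & B]; last first.
  by rewrite link_link0 // cards0 mulr_ge0 ?invr_ge0 ?exprn_ge0 ?(ltW r0).
rewrite link_link //; have [->|Xn0] := eqVneq X set0.
  by rewrite setU0 cards0 expr0 invr1 mul1r.
have cU : #|B :|: X| = (#|B| + #|X|)%N.
  by rewrite cardsU setIC (eqP (_ : X :&: B == set0)) ?setI_eq0 // cards0 subn0.
have : ~~ dense (B :|: X).
  apply/negP => /maxB; rewrite cU; rewrite -card_gt0 in Xn0; lia.
rewrite /dense -ltNge cU exprD => lt.
have rB : 0 < r ^+ #|B| by rewrite exprn_gt0.
have rX : 0 < r ^+ #|X| by rewrite exprn_gt0.
rewrite ler_pdivlMl // -(ler_pM2l rB) mulrA ltW //.
exact: lt_le_trans lt dB.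
Qed.

(** This is [misses_bound] with [n] rounds of density [p / n], the total size being at most
    [k * #|G|]. *)
Lemma spread_misses rho p n k G : 0 < p < 1 -> 0 < rho -> (0 < n)%N ->
    128 * n%:R <= rho * p -> G != set0 -> {in G, forall P : {set V}, (#|P| <= k)%N} ->
    spread rho G ->
  \sum_W biased p W * (misses G id W)%:R <= k%:R / 2 ^+ n.
Proof.
move=> /andP[p0 p1] rho0 n0 rp Gn0 Gk spG.
have nR : 0 < n%:R :> R by rewrite ltr0n.
have n1 : 1 <= n%:R :> R by rewrite ler1n.
have G0 : 0 < #|G|%:R :> R by rewrite ltr0n card_gt0.
have d01 : 0 < p / n%:R < 1.
  by rewrite divr_gt0 //= ltr_pdivrMr // mul1r (lt_le_trans p1).
have rd : 128 <= rho * (p / n%:R) by rewrite mulrA ler_pdivlMr.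
have np : n%:R * (p / n%:R) <= p by rewrite mulrCA mulfV ?mulr1 ?gt_eqF.
have isp : index_spread G rho id by move=> X; rewrite -card_link; exact: spG.
have p01 : 0 <= p <= 1 by rewrite !ltW.
rewrite -(ler_pM2r G0); apply: le_trans (misses_bound d01 rho0 rd np p01 isp) _.
rewrite mulrAC [leRHS]mulrC ler_wpM2l ?invr_ge0 ?exprn_ge0 //.
rewrite mulr_natr -sumr_const; apply: ler_sum => P PG.
by rewrite ler_nat Gk.
Qed.

(** Averaging over all colourings: by linearity the expected number of colours [j] whose class
    misses [H j] is at most [m * e]. *)
Lemma exists_colouring m (H : 'I_m -> {set {set V}}) (e : R) : (0 < m)%N ->
    (forall j, \sum_W biased m%:R^-1 W * (misses (H j) id W)%:R <= e) ->
  exists c : V -> 'I_m,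
    #|[set j | misses (H j) id [set v | c v == j]]|%:R <= m%:R * e.
Proof.
move=> m0 He; pose bad (c : {ffun V -> 'I_m}) :=
  #|[set j | misses (H j) id [set v | c v == j]]|.
have [/existsP[c cP]|/existsPn H0] := boolP [exists c, (bad c)%:R <= m%:R * e].
  by exists c.
have j0 : 'I_m by case: m m0 {H He bad H0} => // m _; exact: ord0.
have mV : 0 < m%:R ^+ #|V| :> R by rewrite exprn_gt0 // ltr0n.
have : m%:R ^+ #|V| * (m%:R * e) < \sum_(c : {ffun V -> 'I_m}) (bad c)%:R.
  have -> : m%:R ^+ #|V| * (m%:R * e) = \sum_(c : {ffun V -> 'I_m}) (m%:R * e).
    by rewrite sumr_const card_ffun card_ord -[RHS]mulr_natl natrX.
  apply: ltr_sum => [|c _]; last by rewrite ltNge.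
  (* The strict inequality needs at least one colouring; a constant one serves. *)
  by apply/hasP; exists [ffun=> j0] => //; rewrite mem_index_enum.
have -> : \sum_(c : {ffun V -> 'I_m}) (bad c)%:R =
    \sum_(j < m) m%:R ^+ #|V| * \sum_W biased m%:R^-1 W * (misses (H j) id W)%:R :> R.
  transitivity (\sum_(j < m) \sum_(c : {ffun V -> 'I_m})
      ((misses (H j) id [set v | c v == j])%:R : R)); last first.
    by apply: eq_bigr => j _; rewrite (sum_colour_class j (fun W => (misses (H j) id W)%:R)).
  rewrite exchange_big; apply: eq_bigr => c _ /=.
  rewrite /bad -sum1_card natr_sum big_mkcond; apply: eq_bigr => j _.
  by rewrite inE; case: misses.
rewrite -mulr_sumr ltr_pM2l // ltNge => /negP[].
by rewrite mulr_natl -[m in e *+ m]card_ord -sumr_const; apply: ler_sum => j _; exact: He.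
Qed.

Lemma colour_class_disjoint m (c : V -> 'I_m) i j (Q Q' : {set V}) : i != j ->
  Q \subset [set v | c v == i] -> Q' \subset [set v | c v == j] -> [disjoint Q & Q'].
Proof.
move=> ij Qi Qj; rewrite -setI_eq0; apply/eqP/setP => v; rewrite !inE.
apply/negP => /andP[/(subsetP Qi)]; rewrite inE => /eqP ci /(subsetP Qj).
by rewrite inE ci (negPf ij).
Qed.

(** With [s] colours and failure probability [1 / (2 s)] for each, the expected number of failures
    is at most 1/2, so some colouring has none. *)
Lemma disjoint_transversal s n k rho (H : 'I_s -> {set {set V}}) : (2 <= s)%N ->
    (2 * s * k <= 2 ^ n)%N -> (0 < n)%N -> 128 * n%:R * s%:R <= rho ->
    (forall i, [/\ H i != set0, {in H i, forall P : {set V}, (#|P| <= k)%N} & spread rho (H i)]) ->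
  exists Q : 'I_s -> {set V}, (forall i, Q i \in H i) /\
    (forall i j, i != j -> [disjoint Q i & Q j]).
Proof.
move=> s2 skn n0 rs HH.
have s0 : 0 < s%:R :> R by rewrite ltr0n; lia.
have nR : 0 < n%:R :> R by rewrite ltr0n.
have rho0 : 0 < rho by apply: lt_le_trans rs; rewrite !mulr_gt0.
have [||c cP] := @exists_colouring s H (2 * s%:R)^-1; first by lia.
  move=> j; have [Hn0 Hk Hsp] := HH j.
  apply: le_trans (@spread_misses rho _ n k _ _ rho0 n0 _ Hn0 Hk Hsp) _.
  - by rewrite invr_gt0 s0 invf_lt1 // ltr1n; lia.
  - by rewrite ler_pdivlMr.
  - rewrite ler_pdivrMr ?exprn_gt0 // ler_pdivlMl ?mulr_gt0 //.
    by rewrite -!natrM -natrX ler_nat.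
have hit j : exists2 Q, Q \in H j & Q \subset [set v | c v == j].
  suff : ~~ misses (H j) id [set v | c v == j].
    by rewrite negbK => /existsP[Q /andP[]]; exists Q.
  apply/negP => mj.
  have : (1 <= #|[set j | misses (H j) id [set v | c v == j]]|)%N.
    by rewrite card_gt0; apply/set0Pn; exists j; rewrite inE.
  rewrite -(ler_nat R) => /le_trans/(_ cP).
  by rewrite invfM mulrCA mulfV ?gt_eqF // mulr1 => ?; lra.
have /choice[Q QP] : forall j, exists Q, Q \in H j /\ Q \subset [set v | c v == j].
  by move=> j; have [Q] := hit j; exists Q.
exists Q; split=> [i|i j ij]; first by have [] := QP i.
by apply: colour_class_disjoint ij (QP i).2 (QP j).2.
Qed.

(** For a single family [2 * s] colours can be used and half of them may fail. Failure probability
    1/2 suffices, so [2 ^ n] need not grow with [s]. *)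
Lemma disjoint_members s n k rho (H : {set {set V}}) : (0 < s)%N ->
    (2 * k <= 2 ^ n)%N -> (0 < n)%N -> 256 * n%:R * s%:R <= rho ->
    H != set0 -> {in H, forall P : {set V}, (#|P| <= k)%N} -> spread rho H ->
  exists Q : 'I_s -> {set V}, (forall i, Q i \in H) /\
    (forall i j, i != j -> [disjoint Q i & Q j]).
Proof.
move=> s0 kn n0 rs Hn0 Hk Hsp.
have sR : 0 < s%:R :> R by rewrite ltr0n.
have nR : 0 < n%:R :> R by rewrite ltr0n.
have rho0 : 0 < rho by apply: lt_le_trans rs; rewrite !mulr_gt0.
have mR : 0 < (2 * s)%:R :> R by rewrite ltr0n; lia.
have [||c cP] := @exists_colouring (2 * s) (fun=> H) 2^-1; first by lia.
  move=> j.
  apply: le_trans (@spread_misses rho _ n k _ _ rho0 n0 _ Hn0 Hk Hsp) _.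
  - by rewrite invr_gt0 mR invf_lt1 // ltr1n; lia.
  - by rewrite ler_pdivlMr // natrM; apply: le_trans rs; lra.
  - rewrite ler_pdivrMr ?exprn_gt0 // ler_pdivlMl //.
    by rewrite -!natrM -natrX ler_nat.
pose J := ~: [set j | misses H id [set v | c v == j]].
have sJ : (s <= #|J|)%N.
  rewrite cardsCs setCK card_ord.
  move: cP; rewrite natrM mulrAC mulfV ?mul1r ?pnatr_eq0 // ler_nat; lia.
have hit (j : 'I_(2 * s)) : exists Q, j \in J -> Q \in H /\ Q \subset [set v | c v == j].
  have [|nJ] := boolP (j \in J); last by exists set0.
  by rewrite !inE negbK => /existsP[Q /andP[QH QJ]]; exists Q.
have /choice[Q QP] := hit.
pose g (i : 'I_s) : 'I_(2 * s) := enum_val (widen_ord sJ i).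
have gJ i : g i \in J by exact: enum_valP.
exists (fun i => Q (g i)); split=> [i|i j ij]; first by have [] := QP _ (gJ i).
apply: colour_class_disjoint (QP _ (gJ i)).2 (QP _ (gJ j)).2.
apply: contra ij => /eqP/enum_val_inj/(congr1 val) /= E.
exact/eqP/val_inj.
Qed.

End Spread.

(** * Estimates for binary logarithms *)

Section Log2.
Variable R : realType.
Implicit Types x y : R.

Lemma expR1_le4 : expR 1 <= 4 :> R.
Proof.
have h : expR (- 2^-1) >= 2^-1 :> R.
  by apply: le_trans (expR_ge1Dx _); lra.
have -> : expR 1 = expR 2^-1 * expR 2^-1 :> R by rewrite -expRD; congr expR; lra.
have : expR 2^-1 <= 2 :> R.
  by rewrite -[leLHS]invrK -expRN -[leRHS]invrK lef_pV2 ?posrE ?expR_gt0 ?invr_gt0.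
by move=> h2; rewrite (_ : 4 = 2 * 2); [apply: ler_pM; rewrite ?expR_ge0|ring].
Qed.

Lemma ln2_ge : 2^-1 <= ln 2 :> R.
Proof.
rewrite -ler_expR lnK ?posrE //.
have := expR1_le4; have -> : expR 1 = expR 2^-1 ^+ 2 :> R.
  by rewrite expr2 -expRD; congr expR; lra.
have := expR_ge0 (2^-1 : R); nra.
Qed.

Let ln2_gt0 : 0 < ln 2 :> R.
Proof. by apply: lt_le_trans ln2_ge; rewrite invr_gt0. Qed.

Lemma log2M x y : 0 < x -> 0 < y -> log2 (x * y) = log2 x + log2 y.
Proof. by move=> x0 y0; rewrite /log2 lnM ?posrE // mulrDl. Qed.

Lemma ler_log2 x y : 0 < x -> x <= y -> log2 x <= log2 y.
Proof.
move=> x0 xy; rewrite /log2 ler_wpM2r ?invr_ge0 ?(ltW ln2_gt0) // ler_ln ?posrE //.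
exact: lt_le_trans xy.
Qed.

Lemma log2X x n : 0 < x -> log2 (x ^+ n) = n%:R * log2 x.
Proof. by move=> x0; rewrite /log2 lnXn // -[ln x *+ n]mulr_natl -mulrA. Qed.

Lemma log2_2 : log2 2 = 1 :> R.
Proof. by rewrite /log2 mulfV // gt_eqF. Qed.

Lemma log2_le_nat x n : 0 < x -> (log2 x <= n%:R) = (x <= 2 ^+ n).
Proof.
move=> x0; have -> : n%:R = log2 (2 ^+ n) :> R by rewrite log2X // log2_2 mulr1.
rewrite /log2.
by rewrite ler_pM2r ?invr_gt0 // ler_ln ?posrE ?exprn_gt0.
Qed.

Lemma nat_le_log2 x n : 0 < x -> (n%:R <= log2 x) = (2 ^+ n <= x).
Proof.
move=> x0; have -> : n%:R = log2 (2 ^+ n) :> R by rewrite log2X // log2_2 mulr1.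
rewrite /log2.
by rewrite ler_pM2r ?invr_gt0 // ler_ln ?posrE ?exprn_gt0.
Qed.

Lemma log2_ge1 x : 2 <= x -> 1 <= log2 x.
Proof.
by move=> x2; have := @nat_le_log2 x 1; rewrite expr1 => -> //; apply: lt_le_trans x2.
Qed.

Lemma exists_up_log (m : nat) : (0 < m)%N ->
  exists n, [/\ (0 < n)%N, (m <= 2 ^ n)%N & n%:R <= log2 m%:R + 1 :> R].
Proof.
move=> m0; exists (trunc_log 2 m).+1; split=> //.
  by rewrite ltnW // trunc_log_ltn.
rewrite -natr1 lerD2r nat_le_log2 ?ltr0n //.
by rewrite -natrX ler_nat trunc_logP.
Qed.

(* With j = i - t, log i / log t <= 1 + 2 j / t <= exp (2 j / t). *)
Lemma log2_ratio_expn t i : (2 <= t)%N -> (t <= i)%N ->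
  log2 i%:R ^+ t <= log2 t%:R ^+ t * 16 ^+ (i - t) :> R.
Proof.
move=> t2 ti; set j := (i - t)%N.
have t0 : 0 < t%:R :> R by rewrite ltr0n; lia.
have lt1 : 1 <= log2 t%:R :> R by rewrite log2_ge1 // ler_nat.
have iE : i%:R = t%:R * (1 + j%:R / t%:R) :> R.
  by rewrite mulrDr mulr1 mulrCA mulfV ?gt_eqF // mulr1 -natrD subnKC.
have jt : 0 <= j%:R / t%:R :> R by rewrite divr_ge0.
have ub : log2 i%:R <= log2 t%:R * expR (2 * (j%:R / t%:R)) :> R.
  rewrite iE log2M //; last by lra.
  have h1 : log2 (1 + j%:R / t%:R) <= 2 * (j%:R / t%:R) :> R.
    rewrite /log2 ler_pdivrMr //.
    have := @le_ln1Dx R (j%:R / t%:R); have := ln2_ge; nra.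
  have := expR_ge1Dx (2 * (j%:R / t%:R) : R); nra.
have li : 0 <= log2 i%:R :> R.
  by apply: le_trans (_ : 1 <= _); rewrite // log2_ge1 // ler_nat; lia.
apply: (@le_trans _ _ ((log2 t%:R * expR (2 * (j%:R / t%:R))) ^+ t)).
  by apply: lerXn2r; rewrite ?nnegrE // mulr_ge0 ?expR_ge0 //; lra.
rewrite exprMn ler_wpM2l ?exprn_ge0 //; first by lra.
rewrite -expRM_natl; have -> : t%:R * (2 * (j%:R / t%:R)) = (2 * j)%:R * 1 :> R.
  by rewrite natrM mulr1; field; rewrite gt_eqF.
(* Here [expR 1 <= 4] turns exp (2 j) into at most 16 ^ j. *)
rewrite expRM_natl exprM; apply: lerXn2r; rewrite ?nnegrE ?exprn_ge0 ?expR_ge0 //.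
have := expR1_le4; have := expR_ge0 (1 : R); nra.
Qed.

End Log2.

(** * Lifting sunflowers, and degrees in a spread family *)

Section Lifting.
Variables (R : realType) (V : finType).
Implicit Types (A F G H S T : {set {set V}}) (B C D P Q X : {set V}).

(** At most half of [H] meets [D]. The lost factor 2 is absorbed by [2 ^ #|X|] for nonempty [X], and
    empty [X] is trivial. *)
Lemma spread_avoid (rho : R) H D : 0 < rho -> spread rho H -> H != set0 ->
    2 * #|D|%:R <= rho ->
  let H' := [set Q in H | [disjoint Q & D]] in H' != set0 /\ spread (rho / 2) H'.
Proof.
move=> rho0 spH Hn0 Dr H'.
have H0 : 0 < #|H|%:R :> R by rewrite ltr0n card_gt0.
have meet := spread_meet D rho0 spH.
have cH : #|H|%:R = #|H'|%:R + #|[set Q in H | ~~ [disjoint Q & D]]|%:R :> R.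
  rewrite -natrD -cardsUI; congr (_%:R); set X := _ :&: _.
  rewrite (_ : X = set0) ?cards0 ?addn0; last first.
    by apply/setP => Q; rewrite !inE; case: (Q \in H) => //=; rewrite andbN.
  by apply: eq_card => Q; rewrite !inE; case: (Q \in H) => //=; rewrite orbN.
have half : #|H|%:R <= 2 * #|H'|%:R :> R.
  have : 2 * #|D|%:R * #|H|%:R <= rho * #|H|%:R by rewrite ler_wpM2r.
  move: meet cH; set m := #|[set Q in H | _]|%:R => meet cH h.
  have : rho * (2 * m) <= rho * #|H|%:R by lra.
  rewrite ler_pM2l //; lra.
split; first by rewrite -card_gt0 -(ltr0n R); lra.
move=> X; have [->|Xn0] := eqVneq X set0.
  by rewrite link0 cards0 expr0 invr1 mul1r.
apply: (@le_trans _ _ (rho ^- #|X| * #|H|%:R)).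
  apply: le_trans (spH X); rewrite ler_nat subset_leq_card // linkS //.
  by apply/subsetP => Q; rewrite inE => /andP[].
rewrite expr_div_n invf_div [_ / rho ^+ _]mulrC -mulrA.
rewrite ler_wpM2l ?invr_ge0 ?exprn_ge0 ?(ltW rho0) //; apply: le_trans half _.
rewrite ler_wpM2r // -[leLHS]expr1 ler_weXn2l ?card_gt0 //; lra.
Qed.

(** After discarding link members that meet the union of all [B i], pairwise disjoint [Q i] extend
    the [B i] to members of [F] meeting exactly in [C]. The [B i] may coincide: [#|C| < k] already
    makes the extended sets distinct. *)
Lemma lift_sunflower (s k q n : nat) (r : R) F (B : 'I_s -> {set V}) C :
    (2 <= s)%N -> uniform k F -> (0 < n)%N -> (2 * s * k <= 2 ^ n)%N ->
    128 * n%:R * s%:R <= r / 4 -> 4 * s%:R * q%:R <= r -> (#|C| < k)%N ->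
    (forall i j, i != j -> B i :&: B j = C) -> (forall i, #|B i| <= q)%N ->
    (forall i, exists G, [/\ G \subset F, link G (B i) != set0 &
                             spread (r / 2) (link G (B i))]) ->
  exists2 S : {set {set V}}, S \subset F & sunflower s S /\ core S = C.
Proof.
move=> s2 Fk n0 skn rn rq Ck BC Bq /choice[G GP].
have s0 : 0 < s%:R :> R by rewrite ltr0n; lia.
have nR : 0 < n%:R :> R by rewrite ltr0n.
have r4 : 0 < r / 4 by apply: lt_le_trans rn; rewrite !mulr_gt0.
have r2 : 0 < r / 2 by lra.
pose U := \bigcup_(i < s) B i.
have cU : (#|U| <= s * q)%N.
  rewrite -[s in (s * _)%N]card_ord -sum_nat_const.
  by apply: leq_trans (card_bigcup_le _ _) _; apply: leq_sum => i _.
have Ur : 2 * #|U|%:R <= r / 2.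
  have : #|U|%:R <= s%:R * q%:R :> R by rewrite -natrM ler_nat.
  lra.
pose H i := [set Q in link (G i) (B i) | [disjoint Q & U]].
have HH i : [/\ H i != set0, {in H i, forall P : {set V}, (#|P| <= k)%N} &
               spread (r / 4) (H i)].
  have [GF Ln0 Lsp] := GP i.
  have [h1 h2] := spread_avoid r2 Lsp Ln0 Ur; split=> //; last first.
    by move: h2; rewrite (_ : r / 2 / 2 = r / 4) //; field.
  move=> Q; rewrite inE in_link => /andP[/andP[_ /(subsetP GF)/Fk <-] _].
  exact/subset_leq_card/subsetUl.
have [Q [QH Qdis]] := disjoint_transversal s2 skn n0 rn HH.
pose P i := Q i :|: B i.
have PF i : P i \in F.
  have [GF _ _] := GP i; have := QH i; rewrite inE in_link.
  by move=> /andP[/andP[_ h] _]; apply: (subsetP GF).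
have QB i j : Q i :&: B j = set0.
  apply/eqP; rewrite setI_eq0; have := QH i; rewrite inE => /andP[_].
  by move/disjointWr; apply; rewrite /U bigcup_sup.
have PC i j : i != j -> P i :&: P j = C.
  move=> ij; rewrite /P setIUl !setIUr QB (setIC (B i)) QB BC // setU0 set0U.
  by have := Qdis i j ij; rewrite -setI_eq0 => /eqP ->; rewrite set0U.
have Pinj : injective P.
  move=> i j E; apply/eqP; apply: contraTT Ck => /PC; rewrite E setIid -leqNgt.
  by move=> <-; rewrite (Fk _ (PF j)).
have [h1 h2] := sunflower_image s2 Pinj PC.
exists [set P i | i in 'I_s] => //.
by apply/subsetP => _ /imsetP[i _ ->].
Qed.

Lemma subset_of_card B (t : nat) : (t <= #|B|)%N ->
  exists2 T : {set V}, T \subset B & #|T| = t.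
Proof.
case/card_geqP => e [ue se eB]; exists [set x in e].
  by apply/subsetP => x; rewrite inE => /eB.
by rewrite cardsE; have/card_uniqP -> := ue.
Qed.

(** For a [t]-subset [T] of [B], the link of [A] at [B] is the link of [link A T] at [B :\: T], and
    [link A T] is [r]-spread. *)
Lemma card_link_le_max_degree (t : nat) (r : R) A B : 0 < r -> rt_spread r t A ->
  (t <= #|B|)%N -> #|link A B|%:R <= r ^- (#|B| - t) * (max_degree t A)%:R.
Proof.
move=> r0 spA tB; have [->|] := eqVneq (link A B) set0.
  by rewrite cards0 mulr_ge0 ?invr_ge0 ?exprn_ge0 ?(ltW r0).
case/set0Pn => Q; rewrite in_link => /andP[_ QA].
have [T TB cT] := subset_of_card tB.
have Tsh : T \in shadow t A.
  apply/bigcupP; exists (Q :|: B) => //; rewrite inE cT eqxx andbT.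
  exact/(subset_trans TB)/subsetUr.
have Tle : T \in shadow_le t A by apply/bigcupP; exists ord_max.
have := spA _ Tle (B :\: T).
rewrite link_link; last first.
  by rewrite -setI_eq0; apply/eqP/setP => v; rewrite !inE; case: (v \in T); rewrite ?andbF.
have -> : T :|: B :\: T = B.
  apply/setP => v; rewrite !inE; have := subsetP TB v.
  by case: (v \in T) => [/(_ isT) ->|_].
rewrite cardsD (setIidPr TB) cT => /le_trans; apply.
rewrite ler_wpM2l ?invr_ge0 ?exprn_ge0 ?(ltW r0) // ler_nat.
exact: (@leq_bigmax_cond _ (mem (shadow t A)) (fun X => #|link A X|) T Tsh).
Qed.

End Lifting.

(** * Minimal covering families and the sizes of their layers *)

Section Peeling.
Variables (R : realType) (V : finType).
Implicit Types (A F G H S T W : {set {set V}}) (B C D P Q X Y : {set V}).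

Definition cores_ge (s t : nat) T : Prop :=
  forall S : {set {set V}}, S \subset T -> sunflower s S -> (t <= #|core S|)%N.

(* A petal X of a sunflower can be exchanged for a superset of X in W that meets
   the other petals only inside X. *)
Lemma sunflower_exchange s t q T X (b : R) W : (2 <= s)%N -> cores_ge s t T ->
    (forall B, B \in T -> (#|B| <= q)%N) -> W \subset T -> link W X != set0 ->
    (s * q)%:R < b -> spread b (link W X) ->
  cores_ge s t (X |: [set B in T | ~~ (X \subset B)]).
Proof.
move=> s2 hT Tq WT Ln0 sqb spL S ST [cS hS].
have [XS|XS] := boolP (X \in S); last first.
  apply: hT => //; apply/subsetP => B BS.
  have /setU1P[BX|/setIdP[//]] := subsetP ST _ BS.
  by rewrite -BX BS in XS.
pose D := \bigcup_(B in S :\ X) B.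
have memS B : B \in S -> B != X -> (B \in T) /\ ~~ (X \subset B).
  move=> BS /eqP BX; have /setU1P[//|/setIdP[-> ->] //] := subsetP ST _ BS.
have b0 : 0 < b by apply: le_lt_trans sqb.
have cD : (#|D| <= s * q)%N.
  apply: leq_trans (card_bigcup_le _ _) _.
  apply: (@leq_trans (\sum_(B in S :\ X) q)).
    by apply: leq_sum => B /setD1P[BX BS]; apply: Tq; have [] := memS B BS BX.
  rewrite sum_nat_const leq_mul2r -cS subset_leq_card ?orbT //; exact: subD1set.
(* Not every link member meets [D], since [b] exceeds [s * q] and hence [#|D|]. Then [Q :|: X] meets
   every other petal just where [X] does. *)
have [Q QL QD] : exists2 Q, Q \in link W X & [disjoint Q & D].
  have [/existsP[Q /andP[QL QD]]|/existsPn no] :=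
    boolP [exists Q, (Q \in link W X) && [disjoint Q & D]]; first by exists Q.
  have := spread_meet D b0 spL.
  have -> : [set Q in link W X | ~~ [disjoint Q & D]] = link W X.
    by apply/setP => Q; rewrite inE; have := no Q; case: (Q \in link W X).
  have L0 : 0 < #|link W X|%:R :> R by rewrite ltr0n card_gt0.
  rewrite ler_pM2r // => bD.
  have : #|D|%:R <= (s * q)%:R :> R by rewrite ler_nat.
  by move=> h; exfalso; lra.
move: QL; rewrite in_link => /andP[QX /(subsetP WT) BT].
set B := Q :|: X in BT.
have XB : X \subset B by rewrite subsetUr.
have BI P : P \in S -> P != X -> B :&: P = core S.
  move=> PS PX; rewrite -(hS X P) // 1?eq_sym // /B setIUl.
  suff -> : Q :&: P = set0 by rewrite set0U.
  apply/eqP; rewrite setI_eq0; apply: disjointWr QD.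
  by apply: bigcup_sup; rewrite !inE PX.
have BnS : B \notin S :\ X.
  by apply/negP => /setD1P[BX BS]; have [_] := memS B BS BX; rewrite XB.
have cS' : #|B |: (S :\ X)| = s.
  by rewrite cardsU1 BnS -cS [in RHS](cardsD1 X) XS.
have [|sun <-] := @sunflower_core V s (B |: (S :\ X)) (core S) s2 cS'.
  move=> P P' /setU1P[->|/setD1P[PX PS]] /setU1P[->|/setD1P[PX' PS']].
  - by rewrite eqxx.
  - by move=> _; apply: BI.
  - by move=> _; rewrite setIC; apply: BI.
  - exact: hS.
apply: hT => //; apply/subsetP => P /setU1P[->//|/setD1P[PX PS]].
by have [] := memS P PS PX.
Qed.

(** Were [link W X] spread, replacing all supersets of [X] in the minimiser by [X] would keep every
    requirement, by [sunflower_exchange], and lower the sum of sizes. That each [X] lies below a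
    member of [S] serves to place the [t]-sets in the shadow of [A]. *)
Lemma exists_peeled s t q S : (2 <= s)%N -> cores_ge s t S ->
    (forall B, B \in S -> (t <= #|B| <= q)%N) ->
  exists T, [/\ forall B, B \in S -> exists2 X, X \in T & X \subset B,
    forall X, X \in T -> (t <= #|X| <= q)%N /\ (exists2 B, B \in S & X \subset B),
    cores_ge s t T &
    forall (b : R) W X, W \subset T -> (t <= #|X|)%N ->
      (forall P, P \in W -> (#|X| < #|P|)%N) -> link W X != set0 ->
      (s * q)%:R < b -> ~ spread b (link W X)].
Proof.
move=> s2 hS Sq.
pose good T := [/\ forall B, B \in S -> exists2 X, X \in T & X \subset B,
    forall X, X \in T -> (t <= #|X| <= q)%N /\ (exists2 B, B \in S & X \subset B) &
    cores_ge s t T].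
pose pot T := (\sum_(B in T) #|B|)%N.
have exn : exists n, `[< exists T, good T /\ pot T = n >].
  exists (pot S); apply/asboolP; exists S; split=> //; split=> // B BS.
    by exists B.
  by split; [exact: Sq|exists B].
case: (ex_minnP exn) => n /asboolP[T [[cov sz sun] potT]] minn.
exists T; split=> // b W X WT tX XW Ln0 sqb spL.
have [B0 B0W XB0] : exists2 B, B \in W & X \subset B.
  by case/set0Pn: Ln0 => Q; rewrite in_link => /andP[_ h]; exists (Q :|: X) => //; rewrite subsetUr.
have B0T := subsetP WT _ B0W.
have [B0q [B1 B1S B01]] := sz _ B0T.
pose T' := X |: [set B in T | ~~ (X \subset B)].
have good' : good T'.
  split; first 1 last.
  - move=> Y /setU1P[->|/setIdP[YT _]]; last exact: sz.
    split; last by exists B1 => //; apply: subset_trans B01.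
    rewrite tX /=; apply: leq_trans (subset_leq_card XB0) _; by case/andP: B0q.
  - apply: sunflower_exchange sqb spL => // B /sz[/andP[]] //.
  move=> B /cov[Y YT YB]; have [XY|XY] := boolP (X \subset Y).
    by exists X; [rewrite setU11|apply: subset_trans YB].
  by exists Y => //; rewrite !inE YT XY orbT.
have : (n <= pot T')%N by apply: minn; apply/asboolP; exists T'.
rewrite -potT leqNgt => /negP[].
rewrite /pot big_setU1 /=; last by rewrite inE subxx andbF.
rewrite [ltnRHS](bigID (fun B => X \subset B)) /=.
have -> : (\sum_(B in [set B in T | ~~ (X \subset B)]) #|B| =
   \sum_(B in T | ~~ (X \subset B)) #|B|)%N by apply: eq_bigl => B; rewrite inE.
rewrite ltn_add2r (bigD1 B0) ?B0T //=.
by have := XW _ B0W; lia.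
Qed.

(** Induction on [i - #|Y|]: a set [X] violating spreadness is nonempty, disjoint from [Y], and
    gives [#|link W Y| < b ^ #|X| * #|link W (Y :|: X)|]. Once [#|Y|] reaches [i], at most one
    member contains [Y]. *)
Lemma card_link_unspread t i (b : R) W : 0 < b -> uniform i W ->
    (forall X, (t <= #|X|)%N -> (#|X| < i)%N -> link W X != set0 ->
       ~ spread b (link W X)) ->
  forall Y, (t <= #|Y|)%N -> #|link W Y|%:R <= b ^+ (i - #|Y|).
Proof.
move=> b0 Wi uns Y; have [m] := ubnP (i - #|Y|)%N.
elim: m Y => // m IH Y lem tY.
have [Yi|iY] := ltnP #|Y| i; last first.
  have -> : (i - #|Y| = 0)%N by lia.
  rewrite expr0 -[1]/(1%:R) ler_nat card_link -(cards1 Y) subset_leq_card //.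
  apply/subsetP => P; rewrite !inE => /andP[/Wi cP YP].
  by rewrite eq_sym eqEcard YP cP.
have [->|Ln0] := eqVneq (link W Y) set0; first by rewrite cards0 exprn_ge0 ?ltW.
have [X] : exists X, ~ (#|link (link W Y) X|%:R <= b ^- #|X| * #|link W Y|%:R).
  by apply/existsNP; exact: uns.
move/negP; rewrite -ltNge => lt.
have XY : [disjoint X & Y].
  apply: contraTT lt => nd; rewrite link_link0 // cards0 -leNgt.
  by rewrite mulr_ge0 ?invr_ge0 ?exprn_ge0 ?(ltW b0).
have Xn0 : (0 < #|X|)%N.
  rewrite card_gt0; apply: contraTneq lt => ->.
  by rewrite link0 cards0 expr0 invr1 mul1r ltxx.
rewrite link_link // ltr_pdivrMl ?exprn_gt0 // in lt.
have cU : #|Y :|: X| = (#|Y| + #|X|)%N.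
  by rewrite cardsU setIC (eqP (_ : X :&: Y == set0)) ?setI_eq0 // cards0 subn0.
apply: ltW; apply: (lt_le_trans lt).
have Ui : (#|Y :|: X| <= i)%N.
  have : link W (Y :|: X) != set0.
    apply: contraTneq lt => ->; rewrite cards0 mulr0 -leNgt //.
  case/set0Pn => Q; rewrite in_link => /andP[_ /Wi <-].
  exact/subset_leq_card/subsetUr.
rewrite cU in Ui.
apply: le_trans (ler_wpM2l _ (IH (Y :|: X) _ _)) _; rewrite ?exprn_ge0 ?(ltW b0) ?cU //; try lia.
rewrite -exprD; have -> : (#|X| + (i - (#|Y| + #|X|)) = i - #|Y|)%N by lia.
exact: lexx.
Qed.

(** Let [B] be a dense set with [a]-spread link. If [#|B| < t], disjoint members of the link give a
    sunflower with core [B], which is excluded. Otherwise [#|W|] is at most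
    [a ^ #|B| * b ^ (i - #|B|)], and [a <= b] finishes. *)
Lemma card_unspread s t i n (a b : R) W : (2 <= s)%N -> (0 < n)%N -> (t <= i)%N ->
    (2 * i <= 2 ^ n)%N -> 256 * n%:R * s%:R <= a -> a <= b ->
    uniform i W -> cores_ge s t W ->
    (forall X, (t <= #|X|)%N -> (#|X| < i)%N -> link W X != set0 ->
       ~ spread b (link W X)) ->
  #|W|%:R <= a ^+ t * b ^+ (i - t).
Proof.
move=> s2 n0 ti i2n an ab Wi hW uns.
have sR : 0 < s%:R :> R by rewrite ltr0n; lia.
have nR : 0 < n%:R :> R by rewrite ltr0n.
have a0 : 0 < a by apply: lt_le_trans an; rewrite !mulr_gt0.
have b0 : 0 < b by apply: lt_le_trans ab.
have [->|Wn0] := eqVneq W set0.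
  by rewrite cards0 mulr_ge0 ?exprn_ge0 ?(ltW a0) ?(ltW b0).
have [B [dB Ln0 spB]] := exists_spread_link a0 Wn0.
have [Bt|tB] := ltnP #|B| t; last first.
  have Bi : (#|B| <= i)%N.
    case/set0Pn: Ln0 => Q; rewrite in_link => /andP[_ /Wi <-].
    exact/subset_leq_card/subsetUr.
  apply: le_trans dB _.
  apply: le_trans (ler_wpM2l _ (card_link_unspread b0 Wi uns tB)) _.
    by rewrite exprn_ge0 // ltW.
  have -> : (i - t = (#|B| - t) + (i - #|B|))%N by lia.
  rewrite -[in a ^+ #|B|](subnKC tB) !exprD -mulrA.
  rewrite ler_wpM2l ?exprn_ge0 ?(ltW a0) // ler_wpM2r ?exprn_ge0 ?(ltW b0) //.
  by apply: lerXn2r; rewrite ?nnegrE ?(ltW a0) ?(ltW b0).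
have Lk : {in link W B, forall P : {set V}, (#|P| <= i)%N}.
  move=> Q; rewrite in_link => /andP[_ /Wi <-]; exact/subset_leq_card/subsetUl.
have s0 : (0 < s)%N by lia.
have [Q [QL Qdis]] := disjoint_members s0 i2n n0 an Ln0 Lk spB.
pose P j := Q j :|: B.
have PW j : P j \in W by have := QL j; rewrite in_link => /andP[].
have PC j j' : j != j' -> P j :&: P j' = B.
  move=> jj; rewrite /P -setUIl; have := Qdis _ _ jj.
  by rewrite -setI_eq0 => /eqP ->; rewrite set0U.
have Pinj : injective P.
  move=> j j' E; apply/eqP; apply: contraTT Bt => /PC; rewrite E setIid -leqNgt.
  by move=> <-; rewrite (Wi _ (PW j')).
have [sun cr] := sunflower_image s2 Pinj PC.
have : (t <= #|B|)%N.
  by rewrite -cr; apply: hW => //; apply/subsetP => _ /imsetP[j _ ->].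
by lia.
Qed.

(** A dense [B] with spread link in the uncovered part has more than [q] elements, since otherwise
    it would be in [S]. The degree bound then leaves [r ^ t / 2 ^ #|B|] times the maximum degree,
    and [2 ^ q.+1] beats [r ^ t.+1]. *)
Lemma card_unapproximated t q (r : R) A F S : 0 < r -> rt_spread r t A ->
    F \subset A -> (t <= q)%N -> r ^+ t.+1 <= 2 ^+ q.+1 ->
    (forall B G, (#|B| <= q)%N -> G \subset F -> link G B != set0 ->
       spread (r / 2) (link G B) -> B \in S) ->
  #|F :\: containing F S|%:R <= (max_degree t A)%:R / r.
Proof.
move=> r0 spA FA tq rq hS; set F' := F :\: _.
have r2 : 0 < r / 2 by lra.
have [->|Fn0] := eqVneq F' set0; first by rewrite cards0 divr_ge0 ?(ltW r0).
have [B [dB Ln0 spB]] := exists_spread_link r2 Fn0.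
have [Bq|qB] := leqP #|B| q.
  have BS : B \in S by apply: hS spB => //; exact: subsetDl.
  case/set0Pn: Ln0 => Q; rewrite in_link => /andP[_ /setDP[QF]].
  rewrite inE QF /= => /existsP[]; exists B; rewrite BS; exact: subsetUr.
apply: le_trans dB _.
have F'A : F' \subset A by apply: subset_trans FA; exact: subsetDl.
have tB : (t <= #|B|)%N by lia.
have := card_link_le_max_degree r0 spA tB.
have : #|link F' B|%:R <= #|link A B|%:R :> R by rewrite ler_nat subset_leq_card // linkS.
move=> h1 h2; apply: le_trans (ler_wpM2l _ (le_trans h1 h2)) _.
  by rewrite exprn_ge0 ?(ltW r2).
rewrite mulrA [leRHS]mulrC ler_wpM2r // expr_div_n.
rewrite ler_pdivrMr ?exprn_gt0 // ler_pdivrMr ?exprn_gt0 // -mulrA ler_pdivlMl //.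
have -> : r * r ^+ #|B| = r ^+ t.+1 * r ^+ (#|B| - t).
  by rewrite -exprS -exprD; congr (_ ^+ _); lia.
rewrite mulrC ler_wpM2l ?exprn_ge0 ?(ltW r0) //; apply: le_trans rq _.
by apply: ler_weXn2l => //; lra.
Qed.

End Peeling.

(** * Counting the sets lost to the larger layers *)

Lemma sum_geometric_le (R : realType) (x : R) m : 0 <= x <= 2^-1 ->
  \sum_(j < m) x ^+ j.+1 <= 2 * x.
Proof.
move=> /andP[x0 x1].
elim: m => [|m IH]; first by rewrite big_ord0 mulr_ge0.
rewrite big_ord_recl expr1.
under eq_bigr do rewrite exprS.
rewrite -mulr_sumr /=.
have : x * (\sum_(i < m) x ^+ i.+1) <= x * (2 * x) by rewrite ler_wpM2l.
nra.
Qed.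

(** Apply [card_unspread] with [a = 2 ^ 10 * s * log2 i] and [b = 2 ^ 10 * s * L]. Replacing log i
    by log t costs 16 ^ (i - t), which raises [2 ^ 10] to [2 ^ 14] in the second factor. *)
Lemma card_size_class (R : realType) (V : finType) (s t q i : nat) (L : R)
    (T : {set {set V}}) : (2 <= s)%N -> (2 <= t)%N -> (t < i)%N -> q%:R <= L ->
    cores_ge s t T -> (forall X, X \in T -> (#|X| <= q)%N) ->
    (forall (b : R) (W : {set {set V}}) (X : {set V}), W \subset T -> (t <= #|X|)%N ->
       (forall P, P \in W -> (#|X| < #|P|)%N) -> link W X != set0 ->
       (s * q)%:R < b -> ~ spread b (link W X)) ->
  #|[set X in T | #|X| == i]|%:R <=
    (2 ^+ 10 * s%:R * log2 t%:R) ^+ t * (2 ^+ 14 * s%:R * L) ^+ (i - t).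
Proof.
move=> s2 t2 ti qL hT Tq uns; set W := [set X in T | _].
have sR : 2 <= s%:R :> R by rewrite ler_nat.
have lt1 : 1 <= log2 t%:R :> R by rewrite log2_ge1 // ler_nat.
have lt0 : 0 <= log2 t%:R :> R by lra.
have L0 : 0 <= L by apply: le_trans qL.
have K0 : 0 <= 2 ^+ 10 * s%:R * log2 t%:R :> R by apply: mulr_ge0; rewrite // mulr_ge0 // exprn_ge0.
have L14 : 0 <= 2 ^+ 14 * s%:R * L by apply: mulr_ge0; rewrite // mulr_ge0 // exprn_ge0.
have [iq|qi] := leqP i q; last first.
  rewrite (_ : W = set0); last first.
    apply/setP => X; rewrite !inE; apply/negP => /andP[/Tq Xq /eqP Xi]; lia.
  by rewrite cards0; apply: mulr_ge0; apply: exprn_ge0.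
have li1 : 1 <= log2 i%:R :> R by rewrite log2_ge1 // ler_nat; lia.
have iL : log2 i%:R <= L.
  apply: le_trans qL; apply: (@le_trans _ _ i%:R); last by rewrite ler_nat.
  by rewrite log2_le_nat ?ltr0n; [rewrite -natrX ler_nat; exact/ltnW/ltn_expl|lia].
have i0 : 0 < i%:R :> R by rewrite ltr0n; lia.
have [n [n0 in2 ni]] := @exists_up_log R (2 * i)%N ltac:(lia).
have sli : s%:R * log2 i%:R <= s%:R * L by rewrite ler_wpM2l.
have ssi : s%:R <= s%:R * log2 i%:R :> R by rewrite ler_peMr.
have WT : W \subset T by apply/subsetP => X; rewrite inE => /andP[].
have Wi : uniform i W by move=> X; rewrite inE => /andP[_ /eqP].
have := @card_unspread R V s t i n (2 ^+ 10 * s%:R * log2 i%:R) (2 ^+ 10 * s%:R * L) W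
  s2 n0 (ltnW ti) in2.
(* As [n <= log2 i + 2 <= 3 * log2 i], the constant 768 would do. *)
have h1 : 256 * n%:R * s%:R <= 2 ^+ 10 * s%:R * log2 i%:R :> R.
  rewrite natrM log2M // log2_2 in ni.
  have : s%:R * n%:R <= s%:R * (1 + log2 i%:R + 1) :> R by rewrite ler_wpM2l.
  by move: sR sli ssi; clear; lra.
have h2 : 2 ^+ 10 * s%:R * log2 i%:R <= 2 ^+ 10 * s%:R * L 
  by rewrite -mulrA -[leRHS]mulrA; apply: ler_wpM2l => //; exact: exprn_ge0.
move=> /(_ h1 h2 Wi).
have hW : cores_ge s t W by move=> S SW; apply: hT; exact: subset_trans WT.
have sq : (s * q)%:R < 2 ^+ 10 * s%:R * L.
  rewrite natrM; have : s%:R * q%:R <= s%:R * L by rewrite ler_wpM2l.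
  by move: sR sli ssi; clear; lra.
move=> /(_ hW) h; apply: le_trans (h _) _.
  move=> X tX Xi Ln0; apply: uns sq => // P PW.
  by rewrite (Wi _ PW).
rewrite (_ : 2 ^+ 14 * s%:R * L = 16 * (2 ^+ 10 * s%:R * L)); last by ring.
have c0 : 0 <= 2 ^+ 10 * s%:R :> R by apply: mulr_ge0; rewrite // exprn_ge0.
move: (2 ^+ 10 * s%:R) c0 => c c0.
rewrite (exprMn (i - t) 16) [leRHS]mulrA; apply: ler_wpM2r; first by rewrite exprn_ge0 ?mulr_ge0.
rewrite (exprMn t _ (log2 i%:R)) (exprMn t _ (log2 t%:R)) -mulrA.
apply: ler_wpM2l; first exact: exprn_ge0.
exact: log2_ratio_expn (ltnW ti).
Qed.

(** A member of [F] containing some [B] of [S] contains a set of [T] below [B]. If it contains no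
    [t]-set of [T], that set is larger, and a union bound over such sets uses their degrees in
    [A]. *)
Lemma card_uncovered_le (R : realType) (V : finType) (t q : nat) (r : R)
    (A F S T : {set {set V}}) : 0 < r -> rt_spread r t A -> F \subset A ->
    (forall B, B \in S -> exists2 X, X \in T & X \subset B) ->
    (forall X, X \in T -> (t <= #|X| <= q)%N) ->
  #|F :\: containing F [set X in T | #|X| == t]|%:R <=
    #|F :\: containing F S|%:R +
    \sum_(j < q) #|[set X in T | #|X| == (t + j.+1)%N]|%:R * r ^- j.+1 *
      (max_degree t A)%:R.
Proof.
move=> r0 spA FA cov sz; set T0 := [set X in T | #|X| == t].
pose big := [set X in T | (t < #|X|)%N].
have sub : F :\: containing F T0 \subset
    (F :\: containing F S) :|: \bigcup_(X in big) [set P in A | X \subset P].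
  apply/subsetP => P /setDP[PF nT]; rewrite in_setU in_setD PF andbT.
  have [|//] := boolP (P \in containing F S).
  rewrite inE PF /= => /existsP[B /andP[BS BP]].
  have [X XT XB] := cov B BS; apply/bigcupP; exists X; last first.
    by rewrite inE (subsetP FA) //= (subset_trans XB).
  rewrite inE XT /=; have /andP[tX _] := sz X XT.
  rewrite ltn_neqAle tX andbT eq_sym; apply: contra nT => Xt.
  rewrite inE PF /=; apply/existsP; exists X.
  by rewrite inE XT Xt (subset_trans XB).
apply: (@le_trans _ _ (#|F :\: containing F S|%:R + \sum_(X in big) #|link A X|%:R)).
  rewrite -natr_sum -natrD ler_nat; apply: leq_trans (subset_leq_card sub) _.
  apply: leq_trans (leq_card_setU _ _) _; rewrite leq_add2l.
  apply: leq_trans (card_bigcup_le _ _) _.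
  by apply: leq_sum => X _; rewrite card_link.
rewrite lerD2l.
apply: (@le_trans _ _ (\sum_(X in big) r ^- (#|X| - t) * (max_degree t A)%:R)).
  apply: ler_sum => X; rewrite inE => /andP[XT tX].
  by apply: card_link_le_max_degree; rewrite // ltnW.
have idx X : X \in big -> (#|X| - t.+1 < q)%N.
  by rewrite inE => /andP[/sz]; lia.
have [q0|q0] := posnP q.
  rewrite big_pred0; last by move=> X; apply/negP => /idx; rewrite q0.
  by apply: sumr_ge0 => j _; rewrite !mulr_ge0 ?invr_ge0 ?exprn_ge0 ?(ltW r0).
(* Index [j] stands for size [t + j + 1]; by [idx] the default of [insubd] is never taken on
   [big]. *)
pose f (X : {set V}) : 'I_q := insubd (Ordinal q0) (#|X| - t.+1)%N.
rewrite (partition_big f xpredT) //=; apply: ler_sum => j _.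
have fE X : X \in big -> (f X == j) = (#|X| == t + j.+1)%N.
  move=> Xb; rewrite -val_eqE /f val_insubd idx //=.
  by move: Xb; rewrite inE => /andP[_ tX]; apply/eqP/eqP; lia.
rewrite -mulrA mulr_natl -sumr_const le_eqVlt; apply/orP; left; apply/eqP.
apply: congr_big => // [X|X /andP[Xb]]; last first.
  by rewrite fE // => /eqP ->; rewrite addKn.
have [Xb|Xb] := boolP (X \in big).
  by rewrite /= fE //; move: Xb; rewrite !inE => /andP[-> _].
rewrite /= inE; apply/esym/negP => /andP[XT /eqP Xj].
by rewrite inE XT Xj /= in Xb; lia.
Qed.

(** * Choice of parameters and assembly of the bound *)

Theorem theorem6 (R : realType) (V : finType) (s t k : nat) (r : R)
    (A F : {set {set V}})
    (hs : (2 <= s)%N) (ht : (2 <= t)%N) (htk : (t <= k)%N)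
    (hAk : uniform k A) (hA : rt_spread r t A)
    (hr1 : 2 ^+ 18 * s%:R * (t%:R + 1) * log2 r <= r)
    (hr2 : 2 ^+ 15 * s%:R * log2 k%:R <= r)
    (hFA : F \subset A)
    (hF : forall S : {set {set V}},
        S \subset F -> sunflower s S -> ~ (#|core S| <= t - 1)%N) :
  exists T : {set {set V}},
    [/\ T \subset shadow t A,
        (forall S : {set {set V}}, S \subset T -> ~ sunflower s S) &
        #|F :\: containing F T|%:R <=
          (2 ^+ 14 * s%:R * log2 t%:R) ^+ t *
          (2 ^+ 19 * s%:R * (t%:R + 1) * log2 r / r) *
          (max_degree t A)%:R].
Proof.
have s_gt0 : (0 < s)%N by exact: ltnW.
have k_ge2 : (2 <= k)%N by exact: leq_trans htk.
have k_gt0 : (0 < k)%N by exact: ltnW.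
have s0 : 0 < s%:R :> R by rewrite ltr0n.
have k0 : 0 < k%:R :> R by rewrite ltr0n.
have [|n [n0 skn nk]] := @exists_up_log R (2 * s * k)%N; first by rewrite !muln_gt0 s_gt0.
have sR : 2 <= s%:R :> R by rewrite ler_nat.
have lk1 : 1 <= log2 k%:R :> R by rewrite log2_ge1 // ler_nat.
have slk : s%:R <= s%:R * log2 k%:R :> R by rewrite ler_peMr.
have rs : 2 ^+ 15 * s%:R <= r.
  by apply: le_trans hr2; rewrite -mulrA ler_wpM2l // exprn_ge0.
have r0 : 0 < r by move: sR rs; clear; lra.
have lr1 : 1 <= log2 r by apply: log2_ge1; move: sR rs; clear; lra.
have lsr : log2 s%:R <= log2 r by apply: ler_log2; move: sR rs; clear; lra.
pose L := (t%:R + 1) * log2 r.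
have tL : t%:R + 1 <= L by rewrite ler_peMr // addr_ge0.
have srL : s%:R * log2 r <= s%:R * L.
  by rewrite ler_wpM2l // /L ler_peMl ?lerDr // (le_trans ler01 lr1).
have rL : 2 ^+ 18 * (s%:R * L) <= r.
  by apply: le_trans hr1; rewrite le_eqVlt; apply/orP; left; apply/eqP; rewrite /L; ring.
have sL : s%:R <= s%:R * L.
  rewrite ler_peMr //; apply: le_trans tL; rewrite lerDr //.
pose q := Num.truncn L.
have /andP[qL Lq] : q%:R <= L < q.+1%:R by apply: Num.Theory.truncn_itv; apply: le_trans tL; rewrite addr_ge0.
have tq : (t <= q)%N.
  by rewrite -ltnS -(ltr_nat R); apply: le_lt_trans Lq; apply: le_trans tL; rewrite lerDl.
(* Here [n <= log2 s + log2 k + 2] and [log2 s <= log2 r], so the two lower bounds on [r] control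
   the two logarithms separately. *)
have rn : 128 * n%:R * s%:R <= r / 4.
  rewrite !natrM !log2M ?mulr_gt0 // log2_2 in nk.
  have : s%:R * n%:R <= s%:R * (1 + log2 r + log2 k%:R + 1) :> R.
    by rewrite ler_wpM2l //; move: nk lsr; clear; lra.
  by move: sR hr2 rs rL srL slk; clear; lra.
have rq4 : 4 * s%:R * q%:R <= r.
  have : s%:R * q%:R <= s%:R * L by rewrite ler_wpM2l.
  by move: sR sL rL; clear; lra.
have Fk : uniform k F by move=> P /(subsetP hFA)/hAk.
pose spr B := exists G : {set {set V}}, [/\ G \subset F, link G B != set0 &
  spread (r / 2) (link G B)].
pose S := [set B : {set V} | (#|B| <= q)%N && `[< spr B >]].
have lift (B : 'I_s -> {set V}) (C : {set V}) : (#|C| < t)%N ->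
    (forall i j, i != j -> B i :&: B j = C) -> ~ (forall i, B i \in S).
  move=> Ct BC BS.
  have Bq i : (#|B i| <= q)%N by have := BS i; rewrite inE => /andP[].
  have Bs i : spr (B i) by have := BS i; rewrite inE => /andP[_ /asboolP].
  have [S' SF [sun cr]] := lift_sunflower hs Fk n0 skn rn rq4 (leq_trans Ct htk) BC Bq Bs.
  by apply: (hF S' SF sun); rewrite cr -ltnS subn1 prednK // ltnW.
(* A member of [S] with fewer than [t] elements would, repeated [s] times, lift to a sunflower with
   itself as core. *)
have Sq B : B \in S -> (t <= #|B| <= q)%N.
  move=> BS; have := BS; rewrite inE => /andP[-> _]; rewrite andbT leqNgt.
  by apply/negP => Bt; apply: (lift (fun=> B) B Bt) => // i j _; rewrite setIid.
have Ssun : cores_ge s t S.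
  move=> S' SS [cS hS]; rewrite leqNgt; apply/negP => ct.
  apply: (lift (fun i => enum_val (cast_ord (esym cS) i)) _ ct) => [i j ij|i].
    apply: hS; rewrite ?enum_valP //.
    by apply: contra ij => /eqP/enum_val_inj/cast_ord_inj/eqP.
  by apply: (subsetP SS); exact: enum_valP.
have [T [cov sz Tsun uns]] := exists_peeled R hs Ssun Sq.
exists [set X in T | #|X| == t]; split.
- apply/subsetP => X; rewrite inE => /andP[XT Xt].
  have [_ [B]] := sz X XT; rewrite inE => /andP[_ /asboolP[G [GF Ln0 _]]] XB.
  case/set0Pn: Ln0 => Q; rewrite in_link => /andP[_ /(subsetP GF)/(subsetP hFA) PA].
  apply/bigcupP; exists (Q :|: B) => //; rewrite inE Xt andbT.
  exact/(subset_trans XB)/subsetUr.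
(* A core of size at least [t] inside [t]-sets equals every petal, contradicting the presence of two
   distinct petals. *)
- move=> S' ST sun; have [cS hS] := sun.
  have tc : (t <= #|core S'|)%N.
    by apply: Tsun sun; apply: subset_trans ST _; apply/subsetP => X; rewrite inE => /andP[].
  have /card_gt1P[P [Q [PS QS PQ]]] : (1 < #|S'|)%N by rewrite cS.
  have eqc X : X \in S' -> core S' = X.
    move=> XS; apply/eqP; rewrite eqEcard bigcap_inf //=.
    by have := subsetP ST _ XS; rewrite inE => /andP[_ /eqP ->].
  by rewrite -(eqc P) // -(eqc Q) // eqxx in PQ.
have sz' X : X \in T -> (t <= #|X| <= q)%N by move=> /sz[].
apply: le_trans (card_uncovered_le r0 hA hFA cov sz') _.
set M := (max_degree t A)%:R.
have M0 : 0 <= M by rewrite ler0n.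
pose K : R := (2 ^+ 10 * s%:R * log2 t%:R) ^+ t.
pose K' : R := (2 ^+ 14 * s%:R * log2 t%:R) ^+ t.
have lt1 : 1 <= log2 t%:R :> R by rewrite log2_ge1 // ler_nat.
have slt : s%:R <= s%:R * log2 t%:R :> R by rewrite ler_peMr.
have K1 : 1 <= K by rewrite exprn_ege1 //; move: sR slt; clear; lra.
have KK : K <= K'.
  by apply: lerXn2r; rewrite ?nnegrE; move: sR slt; clear; lra.
(* Taking logarithms, this is [L < q + 1], which the floor defining [q] provides. *)
have rq : r ^+ t.+1 <= 2 ^+ q.+1.
  by rewrite -log2_le_nat ?exprn_gt0 // log2X // -natr1 ltW.
have unapp : #|F :\: containing F S|%:R <= M / r.
  apply: (card_unapproximated r0 hA hFA tq rq) => B G Bq GF Ln0 sp.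
  by rewrite inE Bq; apply/asboolP; exists G.
(* The ratio of the geometric series over the layers: size [t + j + 1] contributes at most
   [K * x ^+ j.+1] times the maximum degree. *)
pose x := 2 ^+ 14 * s%:R * L / r.
have x01 : 0 <= x <= 2^-1.
  apply/andP; split.
    apply: divr_ge0 (ltW r0); move: sR sL; clear; lra.
  by rewrite ler_pdivrMr //; move: sR sL rL; clear; lra.
have sumb : \sum_(j < q) #|[set X in T | #|X| == (t + j.+1)%N]|%:R * r ^- j.+1 * M <=
    K * (2 * x) * M.
  rewrite -mulr_suml ler_wpM2r //.
  apply: le_trans (ler_wpM2l _ (sum_geometric_le q x01)); last exact: le_trans ler01 K1.
  rewrite mulr_sumr; apply: ler_sum => j _.
  rewrite /x expr_div_n mulrA ler_wpM2r ?invr_ge0 ?exprn_ge0 ?(ltW r0) //.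
  have ti : (t < t + j.+1)%N by rewrite addnS ltnS leq_addr.
  have Tq X : X \in T -> (#|X| <= q)%N by move=> /sz'/andP[].
  have := card_size_class hs ht ti qL Tsun Tq uns.
  by rewrite addKn.
apply: le_trans (lerD unapp sumb) _.
rewrite [M / r]mulrC -mulrDl ler_wpM2r //.
rewrite -/K'; have sL1 : 1 <= s%:R * L by apply: le_trans sL; move: sR; clear; lra.
(* Since [K * (s * L)] is at least 1, it absorbs the lone 1, and [1 + 2 ^ 15] is below [2 ^ 19]. *)
have -> : r^-1 + K * (2 * x) = (1 + 2 ^+ 15 * (K * (s%:R * L))) * r^-1.
  by rewrite /x; ring.
have -> : K' * (2 ^+ 19 * s%:R * (t%:R + 1) * log2 r / r) =
    2 ^+ 19 * (K' * (s%:R * L)) * r^-1 by rewrite /L; ring.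
rewrite ler_pM2r ?invr_gt0 //.
have : K * (s%:R * L) <= K' * (s%:R * L) by rewrite ler_wpM2r // (le_trans ler01).
have : 1 <= K * (s%:R * L) by apply: mulr_ege1.
by clear; lra.
Qed.
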